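(* The variety of subresiduated semilattices is exactly the class of $\{\to,\wedge\}$-subreducts of subresiduated lattices (viewed as algebras $(A,\wedge,\to,1)$ of type $(2,2,0)$).
   Context: A subresiduated semilattice is an algebra $(A,\wedge,\to,1)$ of type $(2,2,0)$ such that $(A,\wedge)$ is a meet-semilattice with greatest element $1$ (with associated order $\le$) and for all $x,y,z\in A$: (SR1) $(x\wedge y)\to y=1$; (SR2) $x\to y\le z\to(x\to y)$; (SR3) $x\wedge(x\to y)\le y$; (SR4) $z\to(x\wedge y)=(z\to x)\wedge(z\to y)$. A subresiduated lattice is an algebra $(A,\wedge,\vee,\to,0,1)$ of type $(2,2,2,0,0)$ such that $(A,\wedge,\vee,0,1)$ is a bounded distributive lattice and for all $x,y,z\in A$: $x\to x=1$; $x\to y\le z\to(x\to y)$; $x\wedge(x\to y)\le y$; $z\to(x\wedge y)=(z\to x)\wedge(z\to y)$; $(x\vee y)\to z=(x\to z)\wedge(y\to z)$; $(x\to y)\wedge(y\to z)\le x\to z$. A $\{\to,\wedge\}$-subreduct of a subresiduated lattice $A$ is any isomorphic image of a (nonempty) subalgebra of the reduct $(A,\wedge,\to)$; since $1=x\to x$, such a subalgebra contains $1$ and is viewed as an algebra of type $(2,2,0)$. *)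

(* Defs.v *)
(* Algebras are raw operations on an arbitrary type with
   Leibniz equality: MathComp's order structures would restrict the carriers to
   choiceTypes and could not host an algebra not yet known to be a lattice. *)
From mathcomp Require Import ssreflect ssrbool ssrfun.

Set Implicit Arguments.
Unset Strict Implicit.
Unset Printing Implicit Defensive.

Record algebra220 : Type := Algebra220 {
  carrier220 :> Type;
  meet220 : carrier220 -> carrier220 -> carrier220;
  imp220 : carrier220 -> carrier220 -> carrier220;
  one220 : carrier220
}.

Record algebra22200 : Type := Algebra22200 {
  carrier22200 :> Type;
  meet22200 : carrier22200 -> carrier22200 -> carrier22200;
  join22200 : carrier22200 -> carrier22200 -> carrier22200;
  imp22200 : carrier22200 -> carrier22200 -> carrier22200;
  zero22200 : carrier22200;
  one22200 : carrier22200
}.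

Definition meet_le (T : Type) (meet : T -> T -> T) (x y : T) : Prop :=
  meet x y = x.

Definition is_meet_semilattice (T : Type) (meet : T -> T -> T) : Prop :=
  [/\ associative meet, commutative meet & idempotent_op meet].

Definition is_greatest (T : Type) (meet : T -> T -> T) (one : T) : Prop :=
  forall x, meet_le meet x one.

Definition is_least (T : Type) (meet : T -> T -> T) (zero : T) : Prop :=
  forall x, meet_le meet zero x.

Definition is_lattice (T : Type) (meet join : T -> T -> T) : Prop :=
  [/\ is_meet_semilattice meet,
      is_meet_semilattice join,
      (forall x y, meet x (join x y) = x)
    & (forall x y, join x (meet x y) = x)].

Definition is_bounded_distributive_lattice (T : Type)
    (meet join : T -> T -> T) (zero one : T) : Prop :=
  [/\ is_lattice meet join,
      (forall x y z, meet x (join y z) = join (meet x y) (meet x z)),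
      is_least meet zero
    & is_greatest meet one].

Definition subresiduated_semilattice (A : algebra220) : Prop :=
  let meet := @meet220 A in
  let imp := @imp220 A in
  let one := one220 A in
  let le := meet_le meet in
  [/\ is_meet_semilattice meet /\ is_greatest meet one,
      (forall x y, imp (meet x y) y = one),
      (forall x y z, le (imp x y) (imp z (imp x y))),
      (forall x y, le (meet x (imp x y)) y)
    & (forall x y z, imp z (meet x y) = meet (imp z x) (imp z y))].

Definition subresiduated_lattice (L : algebra22200) : Prop :=
  let meet := @meet22200 L in
  let join := @join22200 L in
  let imp := @imp22200 L in
  let zero := zero22200 L in
  let one := one22200 L in
  let le := meet_le meet in
  is_bounded_distributive_lattice meet join zero one /\
  [/\ (forall x, imp x x = one),
      (forall x y z, le (imp x y) (imp z (imp x y))),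
      (forall x y, le (meet x (imp x y)) y)
    & [/\ (forall x y z, imp z (meet x y) = meet (imp z x) (imp z y)),
          (forall x y z, imp (join x y) z = meet (imp x z) (imp y z))
        & (forall x y z, le (meet (imp x y) (imp y z)) (imp x z))]].

Definition meet_imp_subalgebra (L : algebra22200) (S : L -> Prop) : Prop :=
  [/\ (exists x, S x),
      (forall x y, S x -> S y -> S (meet22200 x y))
    & (forall x y, S x -> S y -> S (imp22200 x y))].

(* S has type (2,2,0) with the 1 of L as its constant: being nonempty, a
   subalgebra of (L, /\, ->) contains 1 = x -> x. *)
Definition isomorphism_onto (A : algebra220) (L : algebra22200)
    (S : L -> Prop) (f : A -> L) : Prop :=
  [/\ injective f,
      (forall y, S y <-> exists x, f x = y),
      (forall x y, f (meet220 x y) = meet22200 (f x) (f y)),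
      (forall x y, f (imp220 x y) = imp22200 (f x) (f y))
    & f (one220 A) = one22200 L].

Definition imp_meet_subreduct (A : algebra220) (L : algebra22200) : Prop :=
  exists (S : L -> Prop) (f : A -> L),
    meet_imp_subalgebra S /\ isomorphism_onto S f.

(* Main.v *)
(** Both directions rest on reading [x -> y] as the largest [d] in the set [D]
    of elements with [1 -> d = d] such that [d /\ x <= y].  Given a
    subresiduated semilattice [A], the down-sets of [A] form a bounded
    distributive lattice, in which the down-sets generated by subsets of [D]
    form a bounded sublattice (because [D] is closed under meets).  Setting
    [U -> V] to be the largest such generated down-set [W] with [W /\ U <= V]
    yields a subresiduated lattice, and [a |-> {x | x <= a}] preserves meets,
    implications and the unit. *)
Require Import Defs.
From mathcomp Require Import ssreflect ssrbool ssrfun boolp.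

Set Implicit Arguments.
Unset Strict Implicit.
Unset Printing Implicit Defensive.

(** * Order facts in a meet-semilattice *)

Section Semilattice.

Variables (T : Type) (meet : T -> T -> T).
Hypothesis semilattice_meet : is_meet_semilattice meet.

Local Notation "x <=' y" := (meet_le meet x y) (at level 70).

Lemma meet_le_refl x : x <=' x.
Proof. by have [_ _ idem] := semilattice_meet; exact: idem. Qed.

Lemma meet_le_trans y x z : x <=' y -> y <=' z -> x <=' z.
Proof.
have [assoc _ _] := semilattice_meet.
by rewrite /meet_le => xy yz; rewrite -xy -assoc yz.
Qed.

Lemma meet_le_anti x y : x <=' y -> y <=' x -> x = y.
Proof.
by have [_ comm _] := semilattice_meet; move=> xy yx; rewrite -xy comm.
Qed.

Lemma meet_lel x y : meet x y <=' x.
Proof.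
have [assoc comm idem] := semilattice_meet.
by rewrite /meet_le comm assoc idem.
Qed.

Lemma meet_ler x y : meet x y <=' y.
Proof.
have [assoc _ idem] := semilattice_meet.
by rewrite /meet_le -assoc idem.
Qed.

Lemma meet_le_meet z x y : z <=' x -> z <=' y -> z <=' meet x y.
Proof.
have [assoc _ _] := semilattice_meet.
by rewrite /meet_le => zx zy; rewrite assoc zx.
Qed.

Lemma meet_le_mono x x' y y' :
  x <=' x' -> y <=' y' -> meet x y <=' meet x' y'.
Proof.
move=> xx' yy'; apply: meet_le_meet.
  exact: meet_le_trans (meet_lel _ _) xx'.
exact: meet_le_trans (meet_ler _ _) yy'.
Qed.

End Semilattice.

(** * Stable elements and implication *)

Section SubresiduatedSemilattice.

Variable A : algebra220.
Hypothesis srA : subresiduated_semilattice A.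

Local Notation one := (one220 A).
Local Notation meet := (@meet220 A).
Local Notation imp := (@imp220 A).
Local Notation "x <=' y" := (meet_le meet x y) (at level 70).

(** Membership in the set [D]. By [stable_imp], the stable elements are exactly the values of
    [imp]. *)
Definition stable (d : A) : Prop := imp one d = d.

Let mA : is_meet_semilattice meet.
Proof. by case: srA => [[]]. Qed.

Lemma le_one x : x <=' one.
Proof. by case: srA => [[_ top] _ _ _ _]; exact: top. Qed.

Lemma imp_self x : imp x x = one.
Proof.
have [_ sr1 _ _ _] := srA; have [_ _ idem] := mA.
by rewrite -{1}(idem x) sr1.
Qed.

Lemma imp_mono z x y : x <=' y -> imp z x <=' imp z y.
Proof. by have [_ _ _ _ sr4] := srA; rewrite /meet_le -sr4 => ->. Qed.

Lemma imp_one_le x : imp one x <=' x.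
Proof.
have [_ _ _ sr3 _] := srA; apply: (meet_le_trans mA) (sr3 one x).
exact: meet_le_meet (le_one _) (meet_le_refl mA _).
Qed.

Lemma stable_imp x y : stable (imp x y).
Proof.
have [_ _ sr2 _ _] := srA.
by apply: (meet_le_anti mA); [exact: imp_one_le | exact: sr2].
Qed.

Lemma stable_one : stable one.
Proof. exact: imp_self. Qed.

Lemma stable_meet d e : stable d -> stable e -> stable (meet d e).
Proof. by have [_ _ _ _ sr4] := srA; rewrite /stable sr4 => -> ->. Qed.

(** By [sr2], d = 1 -> d lies below x -> d, which by [sr4] equals x -> (d /\ x); monotonicity
    finishes. With [stable_imp] and [imp_meet_le], this makes x -> y the largest stable d with d /\
    x <= y. *)
Lemma le_imp_stable d x y : stable d -> meet d x <=' y -> d <=' imp x y.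
Proof.
have [_ _ sr2 _ sr4] := srA => d_stable dxy.
apply: (meet_le_trans mA) (imp_mono x dxy).
rewrite sr4 imp_self; apply: (meet_le_meet mA); last exact: le_one.
by rewrite -d_stable; exact: sr2.
Qed.

Lemma imp_meet_le x y : meet (imp x y) x <=' y.
Proof.
have [_ _ _ sr3 _] := srA; have [_ comm _] := mA.
by rewrite comm; exact: sr3.
Qed.

(** * The subresiduated lattice of down-sets *)

Definition down_closed (U : A -> Prop) : Prop :=
  forall x y, x <=' y -> U y -> U x.

Definition downset : Type := {U : A -> Prop | down_closed U}.

Lemma downsetP (U : downset) x y : x <=' y -> sval U y -> sval U x.
Proof. exact: proj2_sig U x y. Qed.

Lemma downset_ext (U V : downset) :
  (forall x, sval U x <-> sval V x) -> U = V.
Proof.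
case: U V => [U dU] [V dV] /= UV; apply: eq_exist.
by apply: funext => x; apply: propext.
Qed.

Lemma ds_meet_subproof (U V : downset) :
  down_closed (fun x => sval U x /\ sval V x).
Proof.
by move=> x y xy [Uy Vy]; split; apply: downsetP xy _.
Qed.

Definition ds_meet (U V : downset) : downset :=
  exist _ _ (@ds_meet_subproof U V).

Lemma ds_join_subproof (U V : downset) :
  down_closed (fun x => sval U x \/ sval V x).
Proof.
move=> x y xy [Uy | Vy]; first by left; exact: downsetP xy Uy.
by right; exact: downsetP xy Vy.
Qed.

Definition ds_join (U V : downset) : downset :=
  exist _ _ (@ds_join_subproof U V).

Lemma ds_imp_subproof (U V : downset) :
  down_closed (fun x => exists d,
    [/\ stable d, x <=' d & forall u, sval U u -> sval V (meet d u)]).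
Proof.
move=> x y xy [d [d_stable yd dUV]]; exists d; split=> //.
exact: (meet_le_trans mA) xy yd.
Qed.

(** As U is down-closed, the condition on d says that every element of U below d lies in V. The
    union of the principal down-sets of such stable d is thus the largest one generated by stable
    elements that meets U inside V. *)
Definition ds_imp (U V : downset) : downset := exist _ _ (@ds_imp_subproof U V).

Lemma ds_zero_subproof : down_closed (fun=> False).
Proof. by []. Qed.

(** Admitting the empty down-set supplies a least element even when [A] has none. *)
Definition ds_zero : downset := exist _ _ (@ds_zero_subproof).

Lemma ds_one_subproof : down_closed (fun=> True).
Proof. by []. Qed.

Definition ds_one : downset := exist _ _ (@ds_one_subproof).

Definition downset_algebra : algebra22200 :=
  Algebra22200 ds_meet ds_join ds_imp ds_zero ds_one.

Lemma ds_leP (U V : downset) :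
  meet_le ds_meet U V <-> forall x, sval U x -> sval V x.
Proof.
split=> [<- x [] // | UV].
by apply: downset_ext => x /=; split=> [[] | Ux] //; split=> //; exact: UV.
Qed.

Lemma downset_distributive :
  is_bounded_distributive_lattice ds_meet ds_join ds_zero ds_one.
Proof.
split; [split; [split | split | |] | | |];
  move=> U; try move=> V; try move=> W; apply: downset_ext => x /=; tauto.
Qed.

Lemma downset_subresiduated : subresiduated_lattice downset_algebra.
Proof.
have [assoc comm _] := mA.
split; first exact: downset_distributive.
split; last split.
- move=> U; apply: downset_ext => x /=; split=> // _; exists one.
  split; [exact: stable_one | exact: le_one |] => u.
  exact: downsetP (meet_ler mA _ _).
- move=> U V W; apply/ds_leP => x [d [d_stable xd dUV]].
  (* The same d serves at both levels, since d /\ w <= d for every w. *)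
  exists d; split=> // w _; exists d; split=> //; exact: meet_lel.
- move=> U V; apply/ds_leP => x [Ux [d [_ xd dUV]]].
  by have := dUV x Ux; rewrite comm xd.
- move=> U V W; apply: downset_ext => x /=; split.
    by move=> [d [d_stable xd dWUV]]; split; exists d; split=> // w /dWUV[].
  move=> [[d [d_stable xd dWU]] [e [e_stable xe eWV]]].
  (* One witness must serve both components; this is where closure of stable elements under meets
     enters. *)
  exists (meet d e); split; [exact: stable_meet | exact: meet_le_meet |].
  move=> w Ww; split.
    apply: downsetP (dWU w Ww); apply: (meet_le_mono mA).
      exact: meet_lel.
    exact: meet_le_refl.
  apply: downsetP (eWV w Ww); apply: (meet_le_mono mA).
    exact: meet_ler.
  exact: meet_le_refl.
- move=> U V W; apply: downset_ext => x /=; split.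
    move=> [d [d_stable xd dUVW]].
    by split; exists d; split=> // u Uu; apply: dUVW; [left | right].
  move=> [[d [d_stable xd dUW]] [e [e_stable xe eVW]]].
  exists (meet d e); split; [exact: stable_meet | exact: meet_le_meet |].
  move=> u [/dUW | /eVW]; apply: downsetP; apply: (meet_le_mono mA);
    by [exact: meet_lel | exact: meet_ler | exact: meet_le_refl].
- move=> U V W; apply/ds_leP => x.
  move=> [[d [d_stable xd dUV]] [e [e_stable xe eVW]]].
  exists (meet d e); split; [exact: stable_meet | exact: meet_le_meet |].
  (* d moves u from U into V, then e moves d /\ u into W. *)
  by move=> u /dUV /eVW; rewrite assoc (comm e).
Qed.

(** * The embedding by principal down-sets *)

Lemma principal_subproof (a : A) : down_closed (fun x => x <=' a).
Proof. by move=> x y; exact: (meet_le_trans mA). Qed.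

Definition principal (a : A) : downset_algebra :=
  exist _ _ (@principal_subproof a).

Lemma principal_inj : injective principal.
Proof.
move=> a b ab.
have le_ab x : x <=' a <-> x <=' b.
  by rewrite -[x <=' a]/(sval (principal a) x) ab.
by apply: (meet_le_anti mA); apply/le_ab; exact: meet_le_refl.
Qed.

Lemma principal_meet a b :
  principal (meet a b) = ds_meet (principal a) (principal b).
Proof.
apply: downset_ext => x /=; split=> [xab | [xa xb]]; last exact: meet_le_meet.
split; apply: (meet_le_trans mA) xab _; first exact: meet_lel.
exact: meet_ler.
Qed.

Lemma principal_imp a b :
  principal (imp a b) = ds_imp (principal a) (principal b).
Proof.
apply: downset_ext => x /=; split=> [xab | [d [d_stable xd dab]]].
  exists (imp a b); split=> [| // | u ua]; first exact: stable_imp.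
  apply: (meet_le_trans mA) (imp_meet_le a b).
  exact: meet_le_mono (meet_le_refl mA _) ua.
(* Testing d on u = a alone gives d /\ a <= b, hence d <= a -> b. *)
apply: (meet_le_trans mA) xd _; apply: le_imp_stable => //.
by apply: dab; exact: meet_le_refl.
Qed.

Lemma principal_one : principal one = ds_one.
Proof. by apply: downset_ext => x /=; split=> // _; exact: le_one. Qed.

Lemma subreduct_downset_algebra : imp_meet_subreduct A downset_algebra.
Proof.
exists (fun U => exists a, principal a = U), principal; split; split.
- by exists (principal one), one.
- by move=> _ _ [a <-] [b <-]; exists (meet a b); exact: principal_meet.
- by move=> _ _ [a <-] [b <-]; exists (imp a b); exact: principal_imp.
- exact: principal_inj.
- by [].
- exact: principal_meet.
- exact: principal_imp.
- exact: principal_one.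
Qed.

End SubresiduatedSemilattice.

(** * Subreducts are subresiduated semilattices *)

Lemma subresiduated_lattice_imp_meet (L : algebra22200) :
  subresiduated_lattice L ->
  forall x y : L, imp22200 (meet22200 x y) y = one22200 L.
Proof.
move=> [[[[_ meetC _] [_ joinC _] _ join_absorb] _ _ top]].
move=> [imp_xx _ _ [_ imp_joinl _]] x y.
(* By absorption the join is y, so 1 = y -> y = 1 /\ ((x /\ y) -> y). *)
have := imp_joinl y (meet22200 x y) y.
by rewrite (meetC x) join_absorb imp_xx meetC top => <-.
Qed.

(** All the axioms are equations, [meet_le] included, so they pull back along the injective
    homomorphism f. *)
Lemma subreduct_subresiduated (A : algebra220) (L : algebra22200) :
  subresiduated_lattice L -> imp_meet_subreduct A L ->
  subresiduated_semilattice A.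
Proof.
move=> srL [S [f [_ [f_inj _ f_meet f_imp f_one]]]].
have imp_meet := subresiduated_lattice_imp_meet srL.
have [[[[assoc comm idem] _ _ _] _ _ top] [_ sr2 sr3 [sr4 _ _]]] := srL.
split; [split; [split |] | | | |];
  move=> x; try move=> y; try move=> z; apply: f_inj;
  rewrite ?(f_meet, f_imp, f_one).
- exact: assoc.
- exact: comm.
- exact: idem.
- exact: top.
- exact: imp_meet.
- exact: sr2.
- exact: sr3.
- exact: sr4.
Qed.

Theorem theorem4p10 (A : algebra220) :
  subresiduated_semilattice A <->
  exists L : algebra22200, subresiduated_lattice L /\ imp_meet_subreduct A L.
Proof.
split=> [srA | [L [srL]]]; last exact: subreduct_subresiduated.
exists (downset_algebra srA); split; first exact: downset_subresiduated.
exact: subreduct_downset_algebra.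
Qed.
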